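(* Let $(A,[-,-],\alpha)$ be a Hom-Malcev algebra, $(V,\varrho,\beta)$ a representation of it, and $T:V\to A$ a Kupershmidt operator on $(A,[-,-],\alpha,\varrho,\beta)$. Define a product on $V$ by $a\cdot b=\varrho(T(a))b$ for $a,b\in V$. Then: (1) $(V,\cdot,\beta)$ is a Hom-pre-Malcev algebra; the commutator $[a,b]_T=a\cdot b-b\cdot a$ makes $(V,[-,-]_T,\beta)$ a Hom-Malcev algebra, and $T$ is a homomorphism of Hom-Malcev algebras from $(V,[-,-]_T,\beta)$ to $(A,[-,-],\alpha)$. (2) $T(V)=\{T(a): a\in V\}\subset A$ is a Hom-Malcev subalgebra of $(A,[-,-],\alpha)$, and $T(V)$ carries a Hom-pre-Malcev algebra structure (with twisting map the restriction of $\alpha$) given by $T(a)\cdot T(b)=T(a\cdot b)$ for all $a,b\in V$. (3) The commutator Hom-Malcev algebra structure on $T(V)$ associated with the Hom-pre-Malcev structure in (2) coincides with the Hom-Malcev subalgebra structure inherited from $(A,[-,-],\alpha)$, and $T$ is a morphism of Hom-pre-Malcev algebras from $(V,\cdot,\beta)$ to $T(V)$.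
   Context: All vector spaces are over a field $\mathbb K$ of characteristic $0$. A Hom-Malcev algebra $(A,[-,-],\alpha)$ is a vector space $A$ with an anti-symmetric bilinear bracket and a linear map $\alpha:A\to A$ such that for all $x,y,z,t\in A$, $$[\alpha([x,z]),\alpha([y,t])]=[[[x,y],\alpha(z)],\alpha^2(t)]+[[[y,z],\alpha(t)],\alpha^2(x)]+[[[z,t],\alpha(x)],\alpha^2(y)]+[[[t,x],\alpha(y)],\alpha^2(z)].$$ A Hom-Malcev subalgebra is a subspace closed under the bracket and under $\alpha$. A representation $(V,\varrho,\beta)$ of $(A,[-,-],\alpha)$ is a vector space $V$ with $\beta\in\mathrm{End}(V)$ and a linear map $\varrho:A\to \mathrm{End}(V)$ such that for all $x,y,z\in A$: $\varrho(\alpha(x))\beta=\beta\varrho(x)$ and $$\varrho([[x,y],\alpha(z)])\beta^2=\varrho(\alpha^2(x))\varrho(\alpha(y))\varrho(z)-\varrho(\alpha^2(z))\varrho(\alpha(x))\varrho(y)+\varrho(\alpha^2(y))\varrho([z,x])\beta-\varrho(\alpha([y,z]))\varrho(\alpha(x))\beta.$$ A Kupershmidt operator on $(A,[-,-],\alpha,\varrho,\beta)$ is a linear map $T:V\to A$ with $\alpha\circ T=T\circ\beta$ and $[T(a),T(b)]=T\big(\varrho(T(a))b-\varrho(T(b))a\big)$ for all $a,b\in V$. A Hom-pre-Malcev algebra $(B,\cdot,\gamma)$ is a vector space $B$ with a bilinear product $\cdot$ and a linear map $\gamma:B\to B$ such that for all $x,y,z,t\in B$, writing $[x,y]=x\cdot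 y-y\cdot x$, $$\gamma([y,z])\cdot\gamma(x\cdot t)+[[x,y],\gamma(z)]\cdot\gamma^2(t)+\gamma^2(y)\cdot([x,z]\cdot\gamma(t))-\gamma^2(x)\cdot(\gamma(y)\cdot(z\cdot t))+\gamma^2(z)\cdot(\gamma(x)\cdot(y\cdot t))=0.$$ Morphisms of Hom-Malcev (resp. Hom-pre-Malcev) algebras are linear maps preserving the brackets (resp. products) and intertwining the twisting maps. *)

(* Defs.v *)
From HB Require Import structures.
From mathcomp Require Import all_boot all_algebra.
From mathcomp Require Import boolp.

Set Implicit Arguments.
Unset Strict Implicit.
Unset Printing Implicit Defensive.

Import GRing.Theory.
Local Open Scope ring_scope.

Definition commutator (U : zmodType) (op : U -> U -> U) (x y : U) : U :=
  op x y - op y x.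

Section HomAlgebras.
Variables (K : fieldType) (U : lmodType K).
Implicit Types (op : U -> U -> U) (g : {linear U -> U}).

Definition hom_malcev_identity op g : Prop :=
  forall x y z t,
    op (g (op x z)) (g (op y t)) =
      op (op (op x y) (g z)) (g (g t))
      + op (op (op y z) (g t)) (g (g x))
      + op (op (op z t) (g x)) (g (g y))
      + op (op (op t x) (g y)) (g (g z)).

Definition is_hom_malcev op g : Prop :=
  [/\ bilinear_for *:%R *:%R op,
      forall x y, op x y = - op y x
    & hom_malcev_identity op g].

Definition is_hom_malcev_subalgebra op g (S : {pred U}) : Prop :=
  [/\ GRing.submod_closed S,
      {in S &, forall x y, op x y \in S}
    & {in S, forall x, g x \in S}].

Definition hom_pre_malcev_identity op g : Prop :=
  let br := commutator op in
  forall x y z t,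
    op (g (br y z)) (g (op x t))
    + op (br (br x y) (g z)) (g (g t))
    + op (g (g y)) (op (br x z) (g t))
    - op (g (g x)) (op (g y) (op z t))
    + op (g (g z)) (op (g x) (op y t)) = 0.

Definition is_hom_pre_malcev op g : Prop :=
  bilinear_for *:%R *:%R op /\ hom_pre_malcev_identity op g.

End HomAlgebras.

(* Hom-Malcev and Hom-pre-Malcev morphisms satisfy the same condition, once for
   the brackets and once for the products. *)
Definition is_hom_morphism (K : fieldType) (U W : lmodType K)
    (opU : U -> U -> U) (gU : {linear U -> U})
    (opW : W -> W -> W) (gW : {linear W -> W}) (f : {linear U -> W}) : Prop :=
  {morph f : x y / opU x y >-> opW x y} /\ {morph f : x / gU x >-> gW x}.

Section Kupershmidt.
Variables (K : fieldType) (A V : lmodType K).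

(* The twisted representation identities are equalities in End(V), written
   pointwise; [{linear V -> V}] has no module structure of its own, so that the
   linearity of [rho : A -> End(V)] is pointwise as well. *)
Definition is_representation (br : A -> A -> A) (alpha : {linear A -> A})
    (rho : A -> {linear V -> V}) (beta : {linear V -> V}) : Prop :=
  [/\ forall (c : K) (x y : A) (v : V),
        rho (c *: x + y) v = c *: rho x v + rho y v,
      forall (x : A) (v : V), rho (alpha x) (beta v) = beta (rho x v)
    & forall (x y z : A) (v : V),
        rho (br (br x y) (alpha z)) (beta (beta v)) =
          rho (alpha (alpha x)) (rho (alpha y) (rho z v))
          - rho (alpha (alpha z)) (rho (alpha x) (rho y v))
          + rho (alpha (alpha y)) (rho (br z x) (beta v))
          - rho (alpha (br y z)) (rho (alpha x) (beta v))].

Definition is_kupershmidt (br : A -> A -> A) (alpha : {linear A -> A})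
    (rho : A -> {linear V -> V}) (beta : {linear V -> V})
    (T : {linear V -> A}) : Prop :=
  (forall a, alpha (T a) = T (beta a)) /\
  (forall a b, br (T a) (T b) = T (rho (T a) b - rho (T b) a)).

Definition kupershmidt_prod (rho : A -> {linear V -> V}) (T : {linear V -> A})
    (a b : V) : V := rho (T a) b.

End Kupershmidt.

Section LinearImage.
Variables (K : fieldType) (A V : lmodType K) (T : {linear V -> A}).

(* Membership in the image of [T] is undecidable in infinite dimension, hence
   the classical [`[< _ >]]. *)
Definition lin_image : {pred A} := [pred x | `[< exists a, T a = x >]].

Lemma lin_image_submod_closed : GRing.submod_closed lin_image.
Proof.
split=> [|c x y /asboolP[a <-] /asboolP[b <-]]; apply/asboolP.
  by exists 0; rewrite linear0.
by exists (c *: a + b); rewrite linearP.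
Qed.

HB.instance Definition _ :=
  GRing.isSubmodClosed.Build K A lin_image lin_image_submod_closed.

Lemma mem_lin_image (a : V) : T a \in lin_image.
Proof. by apply/asboolP; exists a. Qed.

Record image_space := ImageSpace {
  image_val :> A;
  _ : image_val \in lin_image }.

HB.instance Definition _ := [isSub for image_val].
HB.instance Definition _ := [Choice of image_space by <:].
HB.instance Definition _ := [SubChoice_isSubLmodule of image_space by <:].

(* [T] viewed as a map onto its image. *)
Definition to_image (a : V) : image_space := ImageSpace (mem_lin_image a).

Lemma to_image_is_linear : linear to_image.
Proof. by move=> c a b; apply: val_inj; rewrite /= !linearP. Qed.

HB.instance Definition _ :=
  GRing.isLinear.Build K V image_space *:%R to_image to_image_is_linear.

End LinearImage.

(* Main.v *)
Require Import Defs.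
From HB Require Import structures.
From mathcomp Require Import all_boot all_algebra.
From mathcomp Require Import boolp.

Set Implicit Arguments.
Unset Strict Implicit.
Unset Printing Implicit Defensive.

Import GRing.Theory.
Local Open Scope ring_scope.

(** The Kupershmidt identity says that [T] carries the commutator of the product
    a . b = rho(T a) b to the bracket of A.  With it and the representation
    axiom applied at the points T x, T y, T z, the left-hand side of the
    Hom-pre-Malcev identity on V cancels term by term
    ([kupershmidt_hom_pre_malcev]).  The commutator of any Hom-pre-Malcev product
    is Hom-Malcev, because the Hom-Malcev defect is a sum of four instances of
    the Hom-pre-Malcev one ([commutator_hom_malcev]).

    For the image, T(a . b) = [T a, T b] + T(rho(T b) a) shows that T(a . b)
    depends only on T a and T b ([kupershmidt_prod_compat]), so the product
    descends along the surjection of V onto T(V).  Bilinearity and the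
    Hom-pre-Malcev identity then pass from V to T(V), as identities do along
    surjective morphisms ([surj_hom_pre_malcev]), and the comparison of brackets
    on T(V) is again the Kupershmidt identity. *)

(** Closes an equality of abelian-group expressions all of whose atoms cancel
    in pairs.  The difference of the two sides is written as a right-associated
    sum ending in 0, so that [addrCA] can bring the opposite of the leading
    atom to the front from any position; pulling it repeatedly terminates only
    because no atom occurs twice with the same sign. *)
Ltac zmod_cancel :=
  apply/eqP; rewrite -subr_eq0; apply/eqP;
  rewrite ?(opprD, opprK) -[LHS]addr0 -?addrA;
  repeat match goal with
  | |- - ?y + _ = 0 => rewrite !(addrCA _ y) addNKr
  | |- ?y + _ = 0 => rewrite !(addrCA _ (- y)) addKr
  end;
  by rewrite ?oppr0 ?addr0.

(** * The commutator of a Hom-pre-Malcev product *)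

Section Commutator.
Variables (K : fieldType) (U : lmodType K).
Implicit Types (op : U -> U -> U) (g : {linear U -> U}).

Lemma bilinear_opNl op (hop : bilinear_for *:%R *:%R op) x y :
  op (- x) y = - op x y.
Proof.
pose f : {linear U -> U} :=
  HB.pack (op^~ y) (GRing.isLinear.Build K U U *:%R _ (hop.1 y)).
exact: (raddfN f).
Qed.

Lemma bilinear_opNr op (hop : bilinear_for *:%R *:%R op) x y :
  op x (- y) = - op x y.
Proof.
pose f : {linear U -> U} :=
  HB.pack (op x) (GRing.isLinear.Build K U U *:%R _ (hop.2 x)).
exact: (raddfN f).
Qed.

Lemma bilinear_opBr op (hop : bilinear_for *:%R *:%R op) x y z :
  op x (y - z) = op x y - op x z.
Proof. exact: (GRing.zmod_morphism_linear (hop.2 x)). Qed.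

Lemma commutatorC op x y : commutator op x y = - commutator op y x.
Proof. by rewrite /commutator opprB. Qed.

Lemma commutator_bilinear op :
  bilinear_for *:%R *:%R op -> bilinear_for *:%R *:%R (commutator op).
Proof.
move=> [opl opr]; split=> z c x y; rewrite /commutator /= opl opr /=.
  by rewrite scalerBr opprD addrACA.
by rewrite scalerBr opprD addrACA.
Qed.

(** Writing P(x, y, z, t) for the left-hand side of the Hom-pre-Malcev
    identity, the Hom-Malcev defect of the commutator is exactly
    P(y,x,z,t) + P(z,y,t,x) + P(t,z,x,y) + P(x,t,y,z): in each of
    these instances the second term of P is, up to sign, a half of one of the
    four double brackets, while the first is one of the four terms in the
    expansion of [g [x, z], g [y, t]]. *)
Lemma commutator_hom_malcev op g :
  is_hom_pre_malcev op g -> is_hom_malcev (commutator op) g.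
Proof.
move=> [hop hP]; split; [exact: commutator_bilinear|exact: commutatorC|].
move=> x y z t.
have /= P1 := hP y x z t; have /= P2 := hP z y t x.
have /= P3 := hP t z x y; have /= P4 := hP x t y z.
have brE a b : commutator op a b = op a b - op b a by [].
have brC : forall a b, commutator op a b = - commutator op b a.
  exact: commutatorC.
have /bilinear_opNl brNl := commutator_bilinear hop.
(* The bracket is made opaque, so that only what has to be compared with the
   terms of P is expanded and the brackets inside P remain atoms. *)
move: (commutator op) brE brC brNl P1 P2 P3 P4 => br brE brC brNl.
have opNl := bilinear_opNl hop; have opNr := bilinear_opNr hop.
have opBr := bilinear_opBr hop.
have gB a b : g (a - b) = g a - g b by exact: raddfB.
have gN a : g (- a) = - g a by exact: raddfN.
have outer a b c d : br (g (br a b)) (g (br c d)) =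
    op (g (br a b)) (g (op c d)) - op (g (br a b)) (g (op d c))
    - (op (g (br c d)) (g (op a b)) - op (g (br c d)) (g (op b a))).
  by rewrite brE {1}(brE c d) {2}(brE a b) !gB !opBr.
have inner u a b c : op u (br (br a b) c) =
    op u (op (br a b) c) - (op u (op c (op a b)) - op u (op c (op b a))).
  by rewrite brE {2}(brE a b) !opBr.
rewrite (brC y x) (brC z y) (brC t z) (brC x t) (brC z x) (brC t y).
rewrite !(brNl, gN, opNl, opNr) => P1 P2 P3 P4.
apply/eqP; rewrite -subr_eq0; apply/eqP.
have := congr2 +%R (congr2 +%R P1 P2) (congr2 +%R P3 P4).
rewrite !addr0 => <-.
rewrite outer !(brE _ (g (g _))) !inner.
zmod_cancel.
Qed.

End Commutator.

(** * Transfer along surjective morphisms *)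

Section Surjection.
Variables (K : fieldType) (U W : lmodType K).
Variables (opU : U -> U -> U) (opW : W -> W -> W).
Variables (gU : {linear U -> U}) (gW : {linear W -> W}) (f : {linear U -> W}).
Hypothesis f_surj : forall w, exists u, f u = w.

Lemma surj_bilinear :
    {morph f : x y / opU x y >-> opW x y} ->
  bilinear_for *:%R *:%R opU -> bilinear_for *:%R *:%R opW.
Proof.
move=> fM [opl opr]; split=> w c x y /=;
  have [[{}w <-] [[{}x <-] [{}y <-]]] := (f_surj w, (f_surj x, f_surj y));
  rewrite -linearP -!fM.
  by rewrite opl linearP.
by rewrite opr linearP.
Qed.

Lemma surj_hom_pre_malcev :
    is_hom_morphism opU gU opW gW f ->
  is_hom_pre_malcev opU gU -> is_hom_pre_malcev opW gW.
Proof.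
move=> [fM fg] [opUbil opUid]; split; first exact: surj_bilinear opUbil.
move=> /= x y z t.
have [[{}x <-] [{}y <-]] := (f_surj x, f_surj y).
have [[{}z <-] [{}t <-]] := (f_surj z, f_surj t).
have fbr : {morph f : a b / commutator opU a b >-> commutator opW a b}.
  by move=> a b; rewrite linearB /= !fM.
rewrite -!(fM, fg, fbr) -!(linearD f, linearB f).
by have /= -> := opUid x y z t; rewrite linear0.
Qed.

End Surjection.

(** * The product of a Kupershmidt operator *)

Section KupershmidtOperator.
Variables (K : fieldType) (A V : lmodType K).
Variables (br : A -> A -> A) (alpha : {linear A -> A}).
Variables (rho : A -> {linear V -> V}) (beta : {linear V -> V}).
Variable T : {linear V -> A}.
Hypothesis malcevA : is_hom_malcev br alpha.
Hypothesis rhoP : is_representation br alpha rho beta.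
Hypothesis kupT : is_kupershmidt br alpha rho beta T.

Local Notation dot := (kupershmidt_prod rho T).

Lemma kupershmidt_commutator a b :
  T (commutator dot a b) = br (T a) (T b).
Proof. by rewrite kupT.2. Qed.

Lemma kupershmidt_hom_morphism :
  is_hom_morphism (commutator dot) beta br alpha T.
Proof. by split=> [a b|a]; rewrite ?kupershmidt_commutator // kupT.1. Qed.

Lemma representationN x v : rho (- x) v = - rho x v.
Proof.
case: rhoP => rhoL _ _.
pose f : {linear A -> V} :=
  HB.pack (fun x => rho x v) (GRing.isLinear.Build K A V *:%R (fun x => rho x v)
    (fun c x y => rhoL c x y v)).
exact: (raddfN f).
Qed.

Lemma kupershmidt_prod_bilinear : bilinear_for *:%R *:%R dot.
Proof.
case: rhoP => rhoL _ _; split=> a c x y; rewrite /kupershmidt_prod /=.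
  by rewrite linearP rhoL.
exact: linearP.
Qed.

(** Since beta(rho(T x) t) = rho(alpha(T x)) (beta t), the first term of the
    identity cancels the last term of the representation axiom for
    rho([[T x, T y], alpha(T z)]) beta^2; of the others, only the one in
    [T x, T z] needs the antisymmetry of the bracket of A. *)
Lemma kupershmidt_hom_pre_malcev : is_hom_pre_malcev dot beta.
Proof.
split; first exact: kupershmidt_prod_bilinear.
case: (rhoP) => _ rho_beta rho_double com x y z t.
have dotE a b : dot a b = rho (T a) b by [].
rewrite {}/com !dotE -!kupT.1 !kupershmidt_commutator -!kupT.1.
rewrite -rho_beta rho_double.
case: malcevA => _ brC _; rewrite (brC (T x) (T z)) representationN linearN.
zmod_cancel.
Qed.

(** By the Kupershmidt identity, T(a . b) = [T a, T b] + T(rho(T b) a), which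
    depends on b only through T b; and a . b = rho(T a) b itself depends on a
    only through T a. *)
Lemma kupershmidt_prod_compat a a' b b' :
  T a = T a' -> T b = T b' -> T (dot a b) = T (dot a' b').
Proof.
have TdotE c d : T (dot c d) = br (T c) (T d) + T (rho (T d) c).
  by rewrite -kupershmidt_commutator linearB subrK.
move=> Ta Tb; have -> : dot a b = dot a' b by rewrite /kupershmidt_prod Ta.
by rewrite (TdotE a' b) (TdotE a' b') Tb.
Qed.

Lemma kupershmidt_image_subalgebra :
  is_hom_malcev_subalgebra br alpha (lin_image T).
Proof.
split; first exact: lin_image_submod_closed.
  move=> _ _ /asboolP[a <-] /asboolP[b <-].
  by rewrite -kupershmidt_commutator mem_lin_image.
by move=> _ /asboolP[a <-]; rewrite kupT.1 mem_lin_image.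
Qed.

Lemma to_image_surj (w : image_space T) : exists a, to_image T a = w.
Proof.
by case: w => x xP; have /asboolP[a Ta] := xP; exists a; apply: val_inj.
Qed.

Definition image_lift (w : image_space T) : V := sval (cid (to_image_surj w)).

Lemma image_liftK : cancel image_lift (to_image T).
Proof. by move=> w; rewrite /image_lift; case: cid. Qed.

Lemma T_image_lift w : T (image_lift w) = val w.
Proof. by rewrite -[in RHS](image_liftK w). Qed.

(** Products and twists are computed on arbitrarily chosen preimages; that the
    choice is harmless is [to_image_prod] and [val_image_twist]. *)
Definition image_prod (u w : image_space T) : image_space T :=
  to_image T (dot (image_lift u) (image_lift w)).

Definition image_twist (w : image_space T) : image_space T :=
  to_image T (beta (image_lift w)).

Lemma to_image_prod : {morph to_image T : a b / dot a b >-> image_prod a b}.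
Proof.
move=> a b; apply: val_inj => /=.
by apply: kupershmidt_prod_compat; rewrite T_image_lift.
Qed.

Lemma val_image_twist w : val (image_twist w) = alpha (val w).
Proof. by rewrite /= -kupT.1 T_image_lift. Qed.

Lemma image_twist_is_linear : linear image_twist.
Proof.
move=> c u w; apply: val_inj.
by rewrite val_image_twist !linearP /= -!kupT.1 !T_image_lift.
Qed.

HB.instance Definition _ := GRing.isLinear.Build K (image_space T)
  (image_space T) *:%R image_twist image_twist_is_linear.

(** Linearity of the twist rests on the hypothesis on [T], so outside this
    section the bundled map has to take that hypothesis as an argument. *)
Definition image_twist_linear : {linear image_space T -> image_space T} :=
  image_twist.

Lemma to_image_hom_morphism :
  is_hom_morphism dot beta image_prod image_twist_linear (to_image T).
Proof.
split=> [|a]; first exact: to_image_prod.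
by apply: val_inj; rewrite [RHS]val_image_twist /= kupT.1.
Qed.

Lemma image_hom_pre_malcev : is_hom_pre_malcev image_prod image_twist_linear.
Proof.
exact: surj_hom_pre_malcev to_image_surj to_image_hom_morphism
  kupershmidt_hom_pre_malcev.
Qed.

Lemma val_image_commutator :
  {morph val : u w / commutator image_prod u w >-> br u w}.
Proof.
move=> u w; rewrite -(T_image_lift u) -(T_image_lift w) -kupershmidt_commutator.
by rewrite /commutator [LHS]linearB [RHS]linearB.
Qed.

End KupershmidtOperator.

Theorem proposition3p3 (K : fieldType) (charK0 : [pchar K] =i pred0)
    (A V : lmodType K)
    (br : A -> A -> A) (alpha : {linear A -> A})
    (rho : A -> {linear V -> V}) (beta : {linear V -> V})
    (T : {linear V -> A}) :
  is_hom_malcev br alpha ->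
  is_representation br alpha rho beta ->
  is_kupershmidt br alpha rho beta T ->
  let dot := kupershmidt_prod rho T in
  (* (1) *)
  [/\ is_hom_pre_malcev dot beta,
      is_hom_malcev (commutator dot) beta
    & is_hom_morphism (commutator dot) beta br alpha T] /\
  (* (2) *)
  is_hom_malcev_subalgebra br alpha (lin_image T) /\
  exists (dotT : image_space T -> image_space T -> image_space T)
         (alphaT : {linear image_space T -> image_space T}),
    [/\ forall u : image_space T, val (alphaT u) = alpha (val u),
        forall a b : V,
          dotT (to_image T a) (to_image T b) = to_image T (dot a b)
      & is_hom_pre_malcev dotT alphaT] /\
    (* (3) *)
    [/\ is_hom_malcev (commutator dotT) alphaT,
        {morph val : u v / commutator dotT u v >-> br u v}
      & is_hom_morphism dot beta dotT alphaT (to_image T)].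
Proof.
move=> malcevA rhoP kupT dot.
have preV := kupershmidt_hom_pre_malcev malcevA rhoP kupT.
have preI := image_hom_pre_malcev malcevA rhoP kupT.
split; last split.
- split; [exact: preV | exact: commutator_hom_malcev |].
  exact: kupershmidt_hom_morphism kupT.
- exact: kupershmidt_image_subalgebra kupT.
exists (image_prod rho (T := T)), (image_twist_linear kupT).
split; split.
- exact: val_image_twist kupT.
- by move=> a b; rewrite (to_image_prod kupT).
- exact: preI.
- exact: commutator_hom_malcev preI.
- exact: val_image_commutator kupT.
- exact: to_image_hom_morphism kupT.
Qed.
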